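(* Let $n\in\mathbb N\cup\{\infty\}$ and let $A_{-1},A_0,A_1,G,V$ be $n\times n$ matrices such that $A_0$ is invertible and $$A_1G^2+A_0G+A_{-1}=0,\qquad A_{-1}V^2+A_0V+A_1=0,$$ with $\rho(G)\le1$, $\rho(V)\le1$, $\rho(G)\rho(V)<1$. Let $\widetilde G$ be a given $n\times n$ approximation of $G$, and set $H=G-\widetilde G$, $R(\widetilde G)=A_1\widetilde G^2+A_0\widetilde G+A_{-1}$, $$S=(A_0+A_1\widetilde G)^{-1},\quad Y=V(I-\widetilde GV)^{-1},\quad Z=(I-\widetilde GV)V(I-\widetilde GV)^{-1},$$ $$\widetilde M=\begin{bmatrix}\widetilde G & I \\ -R(\widetilde G) & -(A_0+A_1\widetilde G)\end{bmatrix},\quad \widetilde N=\begin{bmatrix}I & 0 \\ 0 & A_1\end{bmatrix},\quad \check M=\begin{bmatrix}-SA_{-1} & 0 \\ S R(\widetilde G) & I\end{bmatrix},\quad \check N=\begin{bmatrix}I & SA_1 \\ 0 & -SA_1\end{bmatrix}.$$ Then $$\widetilde M\begin{bmatrix}I \\ H\end{bmatrix}=\widetilde N\begin{bmatrix}I \\ H\end{bmatrix}G,\qquad \widetilde M\begin{bmatrix}Y \\ I\end{bmatrix}Z=\widetilde N\begin{bmatrix}Y \\ I\end{bmatrix}.$$ The pencil $\widetilde M-\lambda\widetilde N$ can be transformed into the equivalent pencil $\check M-\lambda\check N$, which is in standard structured form of kind I, and $$\check M\begin{bmatrix}I \\ H\end{bmatrix}=\check N\begin{bmatrix}I \\ H\end{bmatrix}G,\qquad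 \check M\begin{bmatrix}Y \\ I\end{bmatrix}Z=\check N\begin{bmatrix}Y \\ I\end{bmatrix}.$$
   Context: $I$ is the $n\times n$ identity matrix and $\rho(\cdot)$ denotes the spectral radius. When $n=\infty$ the matrices are infinite matrices in a Banach algebra $\mathcal B$ with an operator norm, and $\rho(A)=\sup\{|\lambda|:\lambda I-A\text{ not invertible in }\mathcal B\}$. Two pencils $M-\lambda N$ and $M'-\lambda N'$ are equivalent if there exist nonsingular matrices $S_1,S_2$ such that $M'=S_1MS_2$ and $N'=S_1NS_2$. A pencil $M-\lambda N$ is in standard structured form of kind I if $M=\begin{bmatrix}E&0\\-P&I\end{bmatrix}$ and $N=\begin{bmatrix}I&-Q\\0&F\end{bmatrix}$ for some $n\times n$ matrices $E,F,P,Q$. *)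

(* Defs.v *)
From mathcomp Require Import all_boot all_order all_algebra complex.
From mathcomp Require Import all_classical all_reals all_analysis.

Set Implicit Arguments.
Unset Strict Implicit.
Unset Printing Implicit Defensive.

Import Order.TTheory GRing.Theory Num.Theory.
Import numFieldNormedType.Exports.

Local Open Scope classical_set_scope.
Local Open Scope ring_scope.
Local Open Scope complex_scope.

(* [act] realises every element of an algebra of infinite matrices [mx] as an
   operator on a Banach space of sequences ([coord x j] is the j-th entry of
   the sequence x): (act a x)_i = \sum_j a_ij x_j.  The norm of a is the least
   constant M >= 0 such that `|a x| <= M * `|x| for all x. *)
Definition is_operator_norm (R : realType) (B : Type)
    (mx : B -> nat -> nat -> R[i]) (nrm : B -> R[i])
    (X : completeNormedModType R[i]) (coord : X -> nat -> R[i])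
    (act : B -> X -> X) : Prop :=
  [/\ injective coord,
      forall (c : R[i]) (x y : X) (j : nat),
        coord (c *: x + y) j = c * coord x j + coord y j,
      forall (a : B) (x : X) (i : nat),
        series (fun j : nat => mx a i j * coord x j) @ \oo
          --> (coord (act a x) i : R[i]^o),
      forall (a : B) (x : X), `|act a x| <= nrm a * `|x|
    & forall (a : B) (M : R[i]), 0 <= M ->
        (forall x : X, `|act a x| <= M * `|x|) -> nrm a <= M].

(* Complex Banach algebras of infinite matrices with an operator norm: [infmx]
   identifies the elements of the algebra with infinite matrices, and the
   product is the row-by-column product, with entrywise convergent series.
   As for [`|_|] on normed modules over R[i], the norm is R[i]-valued.
   The [unitAlgType] structure only names the inverse (in the algebra) of its
   invertible elements. *)
Record infMatrixBanachAlg (R : realType) := InfMatrixBanachAlg {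
  ibm_alg :> unitAlgType R[i] ;
  infmx : ibm_alg -> nat -> nat -> R[i] ;
  infmx_inj : injective infmx ;
  infmx_lin : forall (c : R[i]) (a b : ibm_alg) (i j : nat),
    infmx (c *: a + b) i j = c * infmx a i j + infmx b i j ;
  infmx1 : forall i j : nat, infmx 1 i j = (i == j)%:R ;
  infmxM : forall (a b : ibm_alg) (i j : nat),
    series (fun k : nat => infmx a i k * infmx b k j) @ \oo
      --> (infmx (a * b) i j : R[i]^o) ;
  ibm_norm : ibm_alg -> R[i] ;
  ibm_norm_ge0 : forall a : ibm_alg, 0 <= ibm_norm a ;
  ibm_norm_eq0 : forall a : ibm_alg, ibm_norm a = 0 -> a = 0 ;
  ibm_normZ : forall (c : R[i]) (a : ibm_alg),
    ibm_norm (c *: a) = `|c| * ibm_norm a ;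
  ibm_normD : forall a b : ibm_alg, ibm_norm (a + b) <= ibm_norm a + ibm_norm b ;
  ibm_normM : forall a b : ibm_alg, ibm_norm (a * b) <= ibm_norm a * ibm_norm b ;
  ibm_complete : forall u : nat -> ibm_alg,
    (forall e : R[i], 0 < e -> exists N : nat, forall m n : nat,
       (N <= m)%N -> (N <= n)%N -> ibm_norm (u m - u n) < e) ->
    exists l : ibm_alg, forall e : R[i], 0 < e ->
      exists N : nat, forall n : nat, (N <= n)%N -> ibm_norm (u n - l) < e ;
  ibm_operator_norm :
    exists (X : completeNormedModType R[i]) (coord : X -> nat -> R[i])
           (act : ibm_alg -> X -> X),
      is_operator_norm infmx ibm_norm coord act
}.

Definition sup_modulus (R : realType) (D : set R[i]) : R :=
  sup [set complex.Re `|l| | l in D].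

Definition mx_spectral_radius (R : realType) (n : nat) (A : 'M[R[i]]_n) : R :=
  sup_modulus [set l | eigenvalue A l].

Definition alg_spectral_radius (R : realType) (B : infMatrixBanachAlg R)
    (a : B) : R :=
  sup_modulus [set l : R[i] | l%:A - a \isn't a GRing.unit].

(* [unitmx] is only available over commutative rings, whereas the blocks of a
   pencil may themselves be elements of a noncommutative algebra. *)
Definition nonsingular (T : pzRingType) (m : nat) (S : 'M[T]_m) : Prop :=
  exists S' : 'M[T]_m, S *m S' = 1%:M /\ S' *m S = 1%:M.

(* A pencil M - lambda N is represented by the pair of its coefficients. *)
Definition equivalent_pencils (T : pzRingType) (m : nat)
    (M N M' N' : 'M[T]_m) : Prop :=
  exists S1 S2 : 'M[T]_m,
    [/\ nonsingular S1, nonsingular S2, M' = S1 *m M *m S2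
      & N' = S1 *m N *m S2].

Definition standard_structured_form_I (T : pzRingType) (n : nat)
    (M N : 'M[T]_(n + n)) : Prop :=
  exists E F P Q : 'M[T]_n,
    M = block_mx E 0 (- P) 1%:M /\ N = block_mx 1%:M (- Q) 0 F.

(* 2 x 2 and 2 x 1 matrices with entries in an algebra. *)
Definition block_alg (T : pzRingType) (a b c d : T) : 'M[T]_(1 + 1) :=
  block_mx a%:M b%:M c%:M d%:M.

Definition col_alg (T : pzRingType) (a b : T) : 'M[T]_(1 + 1, 1) :=
  col_mx a%:M b%:M.

(* Main.v *)
Require Import Defs.
From mathcomp Require Import all_boot all_order all_algebra complex.
From mathcomp Require Import all_classical all_reals all_analysis.
Import Order.TTheory GRing.Theory Num.Theory.
Import numFieldNormedType.Exports.
Local Open Scope ring_scope.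
Local Open Scope complex_scope.

(** Write [W = A0 + A1 Gt] and [D = 1 - Gt V].  Once the two matrix equations are
   expanded around the approximation [Gt], everything is an identity of
   noncommutative polynomials: the residual satisfies [Res + W H = - A1 H G]
   ([residual_correction]), [(Res V + W D) V = - A1 D] ([residual_dual]) and
   [Res - W Gt = Am1] ([residualB]).  The first two are the second block rows of
   the deflating subspace relations for the pencil [Mt - lambda Nt]; the first
   block rows hold by the choice of [H], [Y] and [Z].

   Turning the second block column of [Mt] into [0, 1] takes block row
   operations only: it amounts to multiplying the pencil on the left by the
   nonsingular matrix [reduction W^-1].  By the third identity this
   produces the structured pencil, and since only the left factor is used, the
   deflating subspaces are literally the same, so the two relations for the
   structured pencil follow by multiplying the previous ones on the left.

   Only inverses of [W] and [D] enter, so the argument is carried out for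
   blocks in ['M[T]_n] over an arbitrary ring [T] ([pencil_relations]).
   Complex matrices are the case of complex [T]; an algebra of infinite
   matrices is the case [n = 1], through the embedding [a |-> a%:M]. *)

Section Residual.

Variables (K : pzRingType) (Am1 A0 A1 G V Gt : K).

Let Res := A1 * Gt ^+ 2 + A0 * Gt + Am1.
Let W := A0 + A1 * Gt.

Lemma residualB : Res - W * Gt = Am1.
Proof.
by rewrite /Res /W expr2 mulrA mulrDl (addrC (A0 * Gt)) addrAC subrr add0r.
Qed.

(** By [residualB], [Res + W (G - Gt) = Am1 + W G], which differs from the
   vanishing [Am1 + A0 G + A1 G ^+ 2] by [A1 (G - Gt) G]. *)
Lemma residual_correction :
  A1 * G ^+ 2 + A0 * G + Am1 = 0 ->
  Res + W * (G - Gt) = - (A1 * (G - Gt) * G).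
Proof.
move=> eqG; have eqG' : A0 * G + Am1 = - (A1 * G * G).
  by apply/eqP; rewrite -addr_eq0 addrC addrA -mulrA -expr2 eqG.
rewrite mulrBr addrCA residualB /W mulrDl addrAC eqG'.
by rewrite mulrBr mulrBl opprB addrC.
Qed.

(** Substituting [Res = Am1 + W Gt] gives [Res V + W (1 - Gt V) = Am1 V + W],
   and the equation for [V] applies after one more multiplication by [V]. *)
Lemma residual_dual :
  Am1 * V ^+ 2 + A0 * V + A1 = 0 ->
  (Res * V + W * (1 - Gt * V)) * V = - (A1 * (1 - Gt * V)).
Proof.
move=> eqV; have ->: Res * V + W * (1 - Gt * V) = Am1 * V + W.
  by rewrite mulrBr mulr1 mulrA addrCA -mulrBl residualB addrC.
have eqV' : Am1 * V * V + A0 * V = - A1.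
  by apply/eqP; rewrite -addr_eq0 -mulrA -expr2 eqV.
by rewrite /W !mulrDl addrA eqV' mulrBr mulr1 opprB mulrA addrC.
Qed.

End Residual.

(** Left multiplication by this matrix adds [S] times the second block row to
   the first one, and multiplies the second block row by [- S]. *)
Definition reduction {T : pzRingType} {n : nat} (S : 'M[T]_n) : 'M[T]_(n + n) :=
  block_mx 1%:M S 0 (- S).

Lemma reduction_nonsingular {T : pzRingType} {n : nat} (W S : 'M[T]_n) :
  S *m W = 1%:M -> W *m S = 1%:M -> nonsingular (reduction S).
Proof.
move=> SW WS; exists (block_mx 1%:M 1%:M 0 (- W)); rewrite /reduction.
rewrite !mulmx_block !(mul0mx, mulmx0, mul1mx, mulmx1, mulmxN, mulNmx) SW WS.
by rewrite !opprK !(addr0, add0r) !subrr -scalar_mx_block.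
Qed.

(** The matrices [S] and [Di] are the inverses of [A0 + A1 Gt] and [1 - Gt V];
   they are given by their defining equations because [invmx] requires a
   commutative ring of entries. *)
Lemma pencil_relations (T : pzRingType) (n : nat)
    (Am1 A0 A1 G V Gt S Di : 'M[T]_n) :
  A1 *m G ^+ 2 + A0 *m G + Am1 = 0 ->
  Am1 *m V ^+ 2 + A0 *m V + A1 = 0 ->
  S *m (A0 + A1 *m Gt) = 1%:M -> (A0 + A1 *m Gt) *m S = 1%:M ->
  Di *m (1%:M - Gt *m V) = 1%:M -> (1%:M - Gt *m V) *m Di = 1%:M ->
  let H := G - Gt in
  let Res := A1 *m Gt ^+ 2 + A0 *m Gt + Am1 in
  let Y := V *m Di in
  let Z := (1%:M - Gt *m V) *m V *m Di in
  let Mt := block_mx Gt 1%:M (- Res) (- (A0 + A1 *m Gt)) in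
  let Nt := block_mx 1%:M 0 0 A1 in
  let Mc := block_mx (- (S *m Am1)) 0 (S *m Res) 1%:M in
  let Nc := block_mx 1%:M (S *m A1) 0 (- (S *m A1)) in
  [/\ Mt *m col_mx 1%:M H = Nt *m col_mx 1%:M H *m G,
      Mt *m col_mx Y 1%:M *m Z = Nt *m col_mx Y 1%:M,
      equivalent_pencils Mt Nt Mc Nc /\ standard_structured_form_I Mc Nc,
      Mc *m col_mx 1%:M H = Nc *m col_mx 1%:M H *m G
    & Mc *m col_mx Y 1%:M *m Z = Nc *m col_mx Y 1%:M].
Proof.
move=> eqG eqV SW WS DiD DDi H Res Y Z Mt Nt Mc Nc.
have McE : Mc = reduction S *m Mt.
  rewrite /reduction mulmx_block !(mul0mx, mul1mx, mulmxN, mulNmx, add0r) SW.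
  rewrite subrr !opprK; congr block_mx.
  rewrite -[Am1](residualB _ _ A0 A1 Gt) !mulmxE -/Res mulrBr mulrA -!mulmxE SW.
  by rewrite mul1mx opprB.
have NcE : Nc = reduction S *m Nt.
  by rewrite /reduction mulmx_block !(mul0mx, mulmx0, mul1mx, mulNmx, addr0, add0r).
have subG : Mt *m col_mx 1%:M H = Nt *m col_mx 1%:M H *m G.
  rewrite !mul_block_col mul_col_mx !(mulmx1, mul1mx, mul0mx, addr0, add0r).
  congr col_mx; first by rewrite /H addrC subrK.
  rewrite mulNmx -opprD; apply/eqP; rewrite eqr_oppLR; apply/eqP.
  exact: residual_correction.
have subV : Mt *m col_mx Y 1%:M *m Z = Nt *m col_mx Y 1%:M.
  rewrite !mul_block_col mul_col_mx !(mulmx1, mul1mx, mul0mx, addr0, add0r).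
  congr col_mx.
    have ->: Gt *m Y + 1%:M = Di.
      by rewrite -DDi /Y mulmxA mulmxBl mul1mx addrC subrK.
    by rewrite /Z !mulmxA DiD mul1mx.
  have ->: - Res *m Y - (A0 + A1 *m Gt)
           = - (Res *m V + (A0 + A1 *m Gt) *m (1%:M - Gt *m V)) *m Di.
    by rewrite !mulNmx mulmxDl -!mulmxA DDi mulmx1 !opprD.
  rewrite /Z !mulmxA -[_ *m Di *m (_ - _)]mulmxA DiD mulmx1 !mulNmx.
  have := residual_dual _ _ A0 A1 V Gt eqV; rewrite -!mulmxE => ->.
  by rewrite mulNmx opprK -mulmxA DDi mulmx1.
split=> //; last 2 first.
- by rewrite McE NcE -!mulmxA subG !mulmxA.
- by rewrite McE NcE -!mulmxA -subV !mulmxA.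
split.
- exists (reduction S), 1%:M; rewrite !mulmx1; split=> //.
  + exact: (reduction_nonsingular _ _ SW WS).
  + by exists 1%:M; rewrite mulmx1.
- exists (- (S *m Am1)), (- (S *m A1)), (- (S *m Res)), (- (S *m A1)).
  by rewrite !opprK.
Qed.

Theorem mainTheorem3 (R : realType) :
  (* finite n *)
  (forall (n : nat) (Am1 A0 A1 G V Gt : 'M[R[i]]_n),
    A0 \in unitmx ->
    A1 *m G ^+ 2 + A0 *m G + Am1 = 0 ->
    Am1 *m V ^+ 2 + A0 *m V + A1 = 0 ->
    mx_spectral_radius G <= 1 ->
    mx_spectral_radius V <= 1 ->
    mx_spectral_radius G * mx_spectral_radius V < 1 ->
    A0 + A1 *m Gt \in unitmx ->
    1%:M - Gt *m V \in unitmx ->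
    let H := G - Gt in
    let Res := A1 *m Gt ^+ 2 + A0 *m Gt + Am1 in
    let S := invmx (A0 + A1 *m Gt) in
    let Y := V *m invmx (1%:M - Gt *m V) in
    let Z := (1%:M - Gt *m V) *m V *m invmx (1%:M - Gt *m V) in
    let Mt := block_mx Gt 1%:M (- Res) (- (A0 + A1 *m Gt)) in
    let Nt := block_mx 1%:M 0 0 A1 in
    let Mc := block_mx (- (S *m Am1)) 0 (S *m Res) 1%:M in
    let Nc := block_mx 1%:M (S *m A1) 0 (- (S *m A1)) in
    [/\ Mt *m col_mx 1%:M H = Nt *m col_mx 1%:M H *m G,
        Mt *m col_mx Y 1%:M *m Z = Nt *m col_mx Y 1%:M,
        equivalent_pencils Mt Nt Mc Nc /\ standard_structured_form_I Mc Nc,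
        Mc *m col_mx 1%:M H = Nc *m col_mx 1%:M H *m G
      & Mc *m col_mx Y 1%:M *m Z = Nc *m col_mx Y 1%:M]) /\
  (* n = infinity *)
  (forall (B : infMatrixBanachAlg R) (Am1 A0 A1 G V Gt : B),
    A0 \is a GRing.unit ->
    A1 * G ^+ 2 + A0 * G + Am1 = 0 ->
    Am1 * V ^+ 2 + A0 * V + A1 = 0 ->
    alg_spectral_radius G <= 1 ->
    alg_spectral_radius V <= 1 ->
    alg_spectral_radius G * alg_spectral_radius V < 1 ->
    A0 + A1 * Gt \is a GRing.unit ->
    1 - Gt * V \is a GRing.unit ->
    let H := G - Gt in
    let Res := A1 * Gt ^+ 2 + A0 * Gt + Am1 in
    let S := (A0 + A1 * Gt)^-1 in
    let Y := V * (1 - Gt * V)^-1 in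
    let Z := (1 - Gt * V) * V * (1 - Gt * V)^-1 in
    let Mt := block_alg Gt 1 (- Res) (- (A0 + A1 * Gt)) in
    let Nt := block_alg 1 0 0 A1 in
    let Mc := block_alg (- (S * Am1)) 0 (S * Res) 1 in
    let Nc := block_alg 1 (S * A1) 0 (- (S * A1)) in
    [/\ Mt *m col_alg 1 H = Nt *m col_alg 1 H *m G%:M,
        Mt *m col_alg Y 1 *m Z%:M = Nt *m col_alg Y 1,
        equivalent_pencils Mt Nt Mc Nc /\ standard_structured_form_I Mc Nc,
        Mc *m col_alg 1 H = Nc *m col_alg 1 H *m G%:M
      & Mc *m col_alg Y 1 *m Z%:M = Nc *m col_alg Y 1]).
Proof.
split=> [n | B] Am1 A0 A1 G V Gt _ eqG eqV _ _ _ uW uD.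
  by apply: pencil_relations => //; rewrite ?mulmxV ?mulVmx.
move=> H Res S Y Z Mt Nt Mc Nc.
have scM (a b : B) : (a * b)%:M = a%:M *m b%:M :> 'M[B]_1 by exact: scalar_mxM.
have scD (a b : B) : (a + b)%:M = a%:M + b%:M :> 'M[B]_1 by exact: raddfD.
have scN (a : B) : (- a)%:M = - a%:M :> 'M[B]_1 by exact: raddfN.
have sc0 : (0 : B)%:M = 0 :> 'M[B]_1 by exact: raddf0.
have scX2 (a : B) : (a ^+ 2)%:M = a%:M ^+ 2 :> 'M[B]_1 by rewrite !expr2 scM.
have scE := (scM, scD, scN, sc0, scX2).
rewrite /Mt /Nt /Mc /Nc /Y /Z /H /Res /block_alg /col_alg !scE.
by apply: pencil_relations; rewrite -?scE ?(eqG, eqV) ?(mulVr, mulrV).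
Qed.
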